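(* Let $H_{\rm eff}$ be an effective $n$-qubit interaction Hamiltonian, decomposed as $$H_{\rm eff}=\sum_{\ell,m_\ell}H_{\ell,m_\ell},$$ where $\ell$ runs over the interaction orders and, for each $\ell$, $m_\ell$ runs over the $\ell$-qubit subgraphs $G_{m_\ell}$, $H_{\ell,m_\ell}$ comprising all the $\ell$-order interaction terms on $G_{m_\ell}$. Then $H_{\rm eff}$ is locally invertible of type I if and only if there is $K\in\mathbf{SU}(2)^{\otimes n}$ such that all the constituents are simultaneously eigenoperators of $\operatorname{Ad}_K$ to the eigenvalue $-1$, i.e. $\operatorname{Ad}_K(H_{\ell,m_\ell})=-H_{\ell,m_\ell}$ for all $\ell$ and $m_\ell$.
   Context: $H_{\rm eff}$ is a traceless Hermitian operator on $(\mathbb C^2)^{\otimes n}$. An interaction term of order $\ell$ is a real multiple of a tensor product of Pauli matrices $\sigma_x,\sigma_y,\sigma_z$ on exactly $\ell$ qubits with the identity on the remaining qubits (e.g. $\sigma_z\otimes\sigma_z\otimes\sigma_z/2$ has $\ell=3$). For each set of $\ell$ qubits (the vertex set of the subgraph $G_{m_\ell}$), $H_{\ell,m_\ell}$ is the sum of all terms in the Pauli-product expansion of $H_{\rm eff}$ acting non-trivially on exactly those $\ell$ qubits. $\mathbf{SU}(2)^{\otimes n}:=\{K_1\otimes\cdots\otimes K_n:K_\ell\in\mathbf{SU}(2)\}$; $\operatorname{Ad}_K(X):=KXK^{-1}$. $H$ is locally invertible of type I if there is $K\in\mathbf{SU}(2)^{\otimes n}$ with $\operatorname{Ad}_K(H)=-H$.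 *)

(* Defs.v *)
From HB Require Import structures.
From mathcomp Require Import all_boot all_order all_algebra.
From mathcomp Require Import reals complex.

Set Implicit Arguments.
Unset Strict Implicit.
Unset Printing Implicit Defensive.

Import Order.TTheory GRing.Theory Num.Theory.
Local Open Scope ring_scope.

(** Operators on (C^2)^{(x) n} are matrices in the computational basis, whose
    vectors are the bit strings [a : {ffun 'I_n -> 'I_2}]; a row or column index
    [i] stands for [bit_string i]. *)
Definition bits (n : nat) := {ffun 'I_n -> 'I_2}.
Definition qdim (n : nat) : nat := #|{: bits n}|.
Definition bit_string (n : nat) (i : 'I_(qdim n)) : bits n := enum_val i.

Lemma qdimE n : qdim n = (2 ^ n)%N.
Proof. by rewrite /qdim card_ffun !card_ord. Qed.

Section Qubits.
Variables (C : numClosedFieldType) (n : nat).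

Notation op := 'M[C]_(qdim n).

(** The matrix of A_0 (x) ... (x) A_{n-1}: the entry at (a, b) is the product of
    the entries A_k(a_k, b_k). *)
Definition tensor (A : 'I_n -> 'M[C]_2) : op :=
  \matrix_(i, j) \prod_k A k (bit_string i k) (bit_string j k).

Definition SU2 (A : 'M[C]_2) : Prop := A \is unitarymx /\ \det A = 1.

Definition local_SU2 (K : op) : Prop :=
  exists2 k : 'I_n -> 'M[C]_2, (forall i, SU2 (k i)) & K = tensor k.

Definition Ad (K X : op) : op := K *m X *m invmx K.

Definition locally_invertible_typeI (H : op) : Prop :=
  exists2 K : op, local_SU2 K & Ad K H = - H.

Definition sigma_x : 'M[C]_2 := delta_mx 0 1 + delta_mx 1 0.
Definition sigma_y : 'M[C]_2 := 'i *: (delta_mx 1 0 - delta_mx 0 1).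
Definition sigma_z : 'M[C]_2 := delta_mx 0 0 - delta_mx 1 1.

Definition pauli (p : 'I_4) : 'M[C]_2 :=
  tnth [tuple 1%:M; sigma_x; sigma_y; sigma_z] p.

Definition pauli_string := {ffun 'I_n -> 'I_4}.

Definition pauli_prod (s : pauli_string) : op := tensor (fun k => pauli (s k)).

(** The qubits on which [pauli_prod s] acts non-trivially; its cardinal is the
    order of the corresponding interaction term. *)
Definition pauli_supp (s : pauli_string) : {set 'I_n} := [set k | s k != 0].

Definition pauli_basis : #|{: pauli_string}|.-tuple op :=
  [tuple pauli_prod (enum_val i) | i < #|{: pauli_string}|].

Definition pauli_coef (H : op) (s : pauli_string) : C :=
  coord pauli_basis (enum_rank s) H.

Definition interaction_term (H : op) (s : pauli_string) : op :=
  pauli_coef H s *: pauli_prod s.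

(** H_{l,m}, with the vertex set G of the subgraph as index (so l = #|G|). *)
Definition constituent (H : op) (G : {set 'I_n}) : op :=
  \sum_(s : pauli_string | pauli_supp s == G) interaction_term H s.

(** [coord] is meaningful only for a free family: the rest of the section checks
    that the Pauli products form a basis, that the constituents of a traceless
    operator add up to it, and that the coefficients of a Hermitian operator are
    real. *)
Lemma mul_tensor A B : tensor A *m tensor B = tensor (fun k => A k *m B k).
Proof.
apply/matrixP => i j; rewrite !mxE.
under [RHS]eq_bigr => k _ do rewrite mxE.
rewrite bigA_distr_bigA /= [RHS](reindex (@bit_string n)) /=; last first.
  by apply: onW_bij; exact: enum_val_bij.
by apply: eq_bigr => l _; rewrite !mxE -big_split.
Qed.

Lemma trace_tensor A : \tr (tensor A) = \prod_k \tr (A k).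
Proof.
rewrite bigA_distr_bigA /= [RHS](reindex (@bit_string n)) /=; last first.
  by apply: onW_bij; exact: enum_val_bij.
by apply: eq_bigr => l _; rewrite !mxE.
Qed.

Lemma trace_pauli_mul p q : \tr (pauli p *m pauli q) = 2 * (p == q)%:R.
Proof.
have i2 : 'i * 'i = -1 :> C by rewrite -expr2 sqrCi.
case: p q => [[|[|[|[|//]]]] Hp] [[|[|[|[|//]]]] Hq];
  rewrite /pauli !(tnth_nth 0) /= /mxtrace !big_ord_recl big_ord0 !mxE;
  rewrite !big_ord_recl !big_ord0 !mxE /=;
  rewrite ?(mulr0, mul0r, mulr1, mul1r, addr0, add0r, subr0, sub0r, oppr0,
    mulrN, mulNr, opprK, subrr, addNr, i2) //.
Qed.

Lemma trace_pauli_prod_mul s t :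
  \tr (pauli_prod s *m pauli_prod t) = 2 ^+ n * (s == t)%:R.
Proof.
rewrite mul_tensor trace_tensor.
under eq_bigr => k _ do rewrite trace_pauli_mul.
rewrite big_split /= prodr_const card_ord; congr (_ * _).
have [->|ne] := eqVneq s t; first by rewrite big1 // => k _; rewrite eqxx.
have /existsP[k /negPf nk] : [exists k, s k != t k].
  apply: contraNT ne => /existsPn h; apply/eqP/ffunP => k.
  by apply/eqP; have := h k; rewrite negbK.
by rewrite (bigD1 k) //= nk mul0r.
Qed.

Lemma pauli_basisE (i : 'I_#|{: pauli_string}|) : pauli_basis`_i = pauli_prod (enum_val i).
Proof. by rewrite -tnth_nth tnth_mktuple. Qed.

Lemma pauli_basis_free : free pauli_basis.
Proof.
apply/freeP => c /(congr1 (fun X => \tr (X *m pauli_prod _))) c0 i.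
have := c0 (enum_val i); rewrite mulmx_suml raddf_sum mul0mx mxtrace0 /=.
under eq_bigr => j _ do
  rewrite pauli_basisE -scalemxAl mxtraceZ trace_pauli_prod_mul.
rewrite (bigD1 i) //= eqxx mulr1 big1 => [|j /negPf ne].
  by rewrite addr0 => /eqP; rewrite mulf_eq0 expf_eq0 pnatr_eq0 andbF orbF => /eqP.
by rewrite (inj_eq enum_val_inj) ne !mulr0.
Qed.

Lemma pauli_basisP : basis_of fullv pauli_basis.
Proof.
rewrite basisEfree pauli_basis_free subvf /= size_tuple.
by rewrite dimvf /dim /= qdimE card_ffun !card_ord -expnMn.
Qed.

Lemma pauli_expansion H : H = \sum_(s : pauli_string) interaction_term H s.
Proof.
rewrite {1}(coord_basis pauli_basisP (memvf H)).
rewrite [RHS](reindex (@enum_val _ {: pauli_string})) /=; last first.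
  by apply: onW_bij; exact: enum_val_bij.
by apply: eq_bigr => i _; rewrite pauli_basisE /interaction_term /pauli_coef enum_valK.
Qed.

Lemma pauli_coefE H s : pauli_coef H s = (2 ^+ n)^-1 * \tr (H *m pauli_prod s).
Proof.
rewrite {2}(pauli_expansion H) mulmx_suml raddf_sum /=.
under eq_bigr => t _ do rewrite -scalemxAl mxtraceZ trace_pauli_prod_mul.
rewrite (bigD1 s) //= eqxx big1 => [|t /negPf->]; last by rewrite !mulr0.
by rewrite addr0 mulr1 mulrC mulfK // expf_neq0 // pnatr_eq0.
Qed.

Lemma constituents_sum H : \tr H = 0 ->
  H = \sum_(G : {set 'I_n} | G != set0) constituent H G.
Proof.
move=> H0; rewrite {1}(pauli_expansion H).
rewrite (partition_big pauli_supp xpredT) //= (bigD1 set0) //=.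
rewrite big1 ?add0r // => s /eqP s0.
suff P1 : pauli_prod s = 1%:M by rewrite /interaction_term pauli_coefE P1 mulmx1 H0 mulr0 scale0r.
have sk k : s k = 0.
  by apply/eqP; move/setP/(_ k): s0; rewrite !inE => /negbFE.
apply/matrixP => i j; rewrite !mxE.
under eq_bigr => k _ do rewrite sk /pauli (tnth_nth 0) /= mxE.
have [->|ne] := eqVneq i j; first by rewrite big1 // => k _; rewrite eqxx.
have /existsP[k /negPf nk] : [exists k, bit_string i k != bit_string j k].
  apply: contraNT ne => /existsPn h; apply/eqP/enum_val_inj/ffunP => k.
  by apply/eqP; have := h k; rewrite negbK.
by rewrite (bigD1 k) //= nk mul0r.
Qed.

Lemma tensor_adj A : map_mx Num.conj (tensor A)^T =
  tensor (fun k => map_mx Num.conj (A k)^T).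
Proof.
apply/matrixP => i j; rewrite !mxE rmorph_prod /=.
by apply: eq_bigr => k _; rewrite !mxE.
Qed.

Lemma pauli_adj p : map_mx Num.conj (pauli p)^T = pauli p.
Proof.
apply/matrixP => i j; rewrite !mxE.
case: p => [[|[|[|[|//]]]] Hp]; rewrite /pauli !(tnth_nth 0) /= !mxE;
  case: i => [[|[|//]] Hi]; case: j => [[|[|//]] Hj] /=;
  by rewrite ?(rmorphB, rmorphD, rmorphM) /= ?conjCi
    ?(conjC0, conjC1, rmorph0, rmorph1, subr0, sub0r, rmorphN, mulrN, mulNr,
      opprK, mulr0, mulr1, addr0, add0r, oppr0) //= ?rmorphN ?rmorph1 ?conjCi
      ?opprK.
Qed.

Lemma pauli_coef_real H s : H \is hermsymmx -> pauli_coef H s \is Num.real.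
Proof.
move=> /is_hermitianmxP; rewrite expr0 scale1r => Hh.
rewrite CrealE pauli_coefE rmorphM fmorphV rmorphXn /= conjC_nat.
apply/eqP; congr (_ * _).
have -> : (\tr (H *m pauli_prod s))^* =
    \tr (map_mx Num.conj (pauli_prod s)^T *m map_mx Num.conj H^T).
  by rewrite -map_mxM -trmx_mul -map_trmx mxtrace_tr trace_map_mx.
rewrite -Hh tensor_adj mxtrace_mulC; congr (\tr (_ *m _)).
apply/matrixP => i j; rewrite !mxE; apply: eq_bigr => k _.
by rewrite pauli_adj.
Qed.

End Qubits.

(* Main.v *)
Require Import Defs.
From HB Require Import structures.
From mathcomp Require Import all_boot all_order all_algebra reals complex.

Import Order.TTheory GRing.Theory Num.Theory.
Local Open Scope ring_scope.

(** Conjugation by an invertible 2x2 matrix fixes the identity and preserves the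
    trace, hence preserves the span of the three Pauli matrices, which is the
    space of traceless matrices. So conjugation by a product operator maps a
    Pauli product supported on G to a combination of Pauli products supported on
    exactly G, and commutes with the projection of H on its constituent at G. *)

Section LocalConjugation.
Variables (C : numClosedFieldType) (n : nat).

Notation op := 'M[C]_(qdim n).

Lemma tensor1 : tensor (fun _ : 'I_n => 1%:M) = 1%:M :> op.
Proof.
apply/matrixP => i j; rewrite !mxE.
have [->|ne] := eqVneq i j; first by rewrite big1 // => k _; rewrite mxE eqxx.
have /existsP[k /negPf nk] : [exists k, bit_string i k != bit_string j k].
  apply: contraNT ne => /existsPn h; apply/eqP/enum_val_inj/ffunP => k.
  by apply/eqP; have := h k; rewrite negbK.
by rewrite (bigD1 k) //= mxE nk mul0r.
Qed.

Lemma invmx_tensor (k : 'I_n -> 'M[C]_2) : (forall i, k i \in unitmx) ->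
  invmx (tensor k) = tensor (fun i => invmx (k i)).
Proof.
move=> ku; have kV : tensor k *m tensor (fun i => invmx (k i)) = 1%:M.
  rewrite mul_tensor -tensor1; apply/matrixP => i j; rewrite !mxE.
  by apply: eq_bigr => l _; rewrite mulmxV.
have [Ku _] := mulmx1_unit kV.
by rewrite -[LHS]mulmx1 -kV mulKmx.
Qed.

Lemma trace_pauli (p : 'I_4) : \tr (pauli C p) = 2 * (p == 0)%:R.
Proof.
by rewrite -trace_pauli_mul {3}/pauli (tnth_nth 0) /= mulmx1.
Qed.

(** Exactly one of the two Pauli matrices is the identity, so [k] and [invmx k] cancel, by cyclicity
    of the trace if it is [pauli C q]. What is left is the trace of a non-identity Pauli matrix. *)
Lemma trace_conj_pauli (k : 'M[C]_2) (p q : 'I_4) : k \in unitmx ->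
  (p == 0) != (q == 0) -> \tr (k *m pauli C p *m invmx k *m pauli C q) = 0.
Proof.
move=> ku; have pauli0 : pauli C 0 = 1%:M by rewrite /pauli (tnth_nth 0).
have [->|p0] := eqVneq p 0.
  rewrite pauli0 mulmx1 mulmxV // mul1mx trace_pauli.
  by case: (q == 0) => //= _; rewrite mulr0.
have [-> _|//] := eqVneq q 0.
by rewrite pauli0 mulmx1 mxtrace_mulC mulKmx // trace_pauli (negPf p0) mulr0.
Qed.

(** Up to a scalar the coefficient is a product of one-qubit traces, and a qubit in exactly one of
    the two supports contributes a factor zero. *)
Lemma pauli_coef_Ad_pauli_prod (k : 'I_n -> 'M[C]_2) (s t : pauli_string n) :
  (forall i, k i \in unitmx) -> pauli_supp s != pauli_supp t ->
  pauli_coef (Ad (tensor k) (pauli_prod C s)) t = 0.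
Proof.
move=> ku ne; rewrite pauli_coefE /Ad invmx_tensor // !mul_tensor trace_tensor.
have /existsP[i ni] : [exists i, (s i == 0) != (t i == 0)].
  apply: contraNT ne => /existsPn h; apply/eqP/setP => i; rewrite !inE.
  by have := h i; rewrite negbK => /eqP->.
by rewrite (bigD1 i) //= trace_conj_pauli // mul0r mulr0.
Qed.

Lemma Ad_is_linear (K : op) : linear (Ad K).
Proof. by move=> a X Y; rewrite /Ad mulmxDr mulmxDl -scalemxAr -scalemxAl. Qed.

HB.instance Definition _ (K : op) :=
  GRing.isLinear.Build C op op _ (Ad K) (Ad_is_linear K).

(** A named constant, with the operator last, is needed to declare linearity. *)
Definition component (G : {set 'I_n}) (X : op) : op := constituent X G.

Lemma component_is_linear (G : {set 'I_n}) : linear (component G).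
Proof.
move=> a X Y; rewrite /component /constituent scaler_sumr -big_split /=.
apply: eq_bigr => s _.
by rewrite /interaction_term /pauli_coef linearP scalerDl scalerA.
Qed.

HB.instance Definition _ (G : {set 'I_n}) :=
  GRing.isLinear.Build C op op _ (component G) (component_is_linear G).

Lemma component_Ad_pauli_prod (k : 'I_n -> 'M[C]_2) (s : pauli_string n)
    (G : {set 'I_n}) : (forall i, k i \in unitmx) ->
  component G (Ad (tensor k) (pauli_prod C s)) =
  if pauli_supp s == G then Ad (tensor k) (pauli_prod C s) else 0.
Proof.
move=> ku; set X := Ad _ _.
have X0 t : pauli_supp s != pauli_supp t -> interaction_term X t = 0.
  by move=> ne; rewrite /interaction_term pauli_coef_Ad_pauli_prod ?scale0r.
case: eqVneq => [<-|ne]; last by apply: big1 => t /eqP tG; rewrite X0 ?tG.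
(* In the full expansion of [X] the terms with support other than that of [s] vanish, so the
   constituent is all of [X]. *)
rewrite [RHS]pauli_expansion (bigID (fun t => pauli_supp t == pauli_supp s)) /=.
by rewrite [X in _ + X]big1 ?addr0 // => t; rewrite eq_sym => /X0.
Qed.

Lemma component_Ad (k : 'I_n -> 'M[C]_2) (H : op) (G : {set 'I_n}) :
  (forall i, k i \in unitmx) ->
  component G (Ad (tensor k) H) = Ad (tensor k) (component G H).
Proof.
move=> ku; rewrite {1}(pauli_expansion H) !linear_sum /= [RHS]big_mkcond.
apply: eq_bigr => s _.
rewrite /interaction_term !linearZ /= component_Ad_pauli_prod //.
by case: ifP => _ //; rewrite scaler0.
Qed.

End LocalConjugation.

Theorem lemma7 (R : realType) (n : nat) (H : 'M[R[i]]_(qdim n))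
    (H_herm : H \is hermsymmx) (H_tr0 : \tr H = 0) :
  locally_invertible_typeI H <->
  exists2 K : 'M[R[i]]_(qdim n), local_SU2 K &
    forall (l : nat) (G : {set 'I_n}), (1 <= l)%N -> #|G| = l ->
      Ad K (constituent H G) = - constituent H G.
Proof.
split=> -[K locK KH]; exists K => //.
  case: locK KH => k kSU -> KH _ G _ _.
  (* Project [Ad K H = - H] onto the constituent at [G]; the same [K] serves for every [G]. *)
  rewrite -[constituent H G]/(component _ _ G H) -component_Ad => [|i]; last first.
    by rewrite unitmxE (proj2 (kSU i)) unitr1.
  by rewrite KH linearN.
(* As [H] is traceless, only nonempty [G] occur in the sum, so the order is at least 1, as [KH]
   demands. *)
rewrite (constituents_sum H_tr0) linear_sum -sumrN; apply: eq_bigr => G G0.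
by apply: (KH #|G|); rewrite ?card_gt0.
Qed.
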